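(* Let $T_1,\dots,T_N:\mathbb{R}^n\rightrightarrows\mathbb{R}^n$ satisfy Assumption 1 and let the mixing matrices $W,\tilde W\in\mathbb{R}^{N\times N}$ satisfy Assumption 2 (both stated in the context). Let $\alpha>0$ be arbitrary, let $z_1^0,\dots,z_N^0\in\mathbb{R}^n$ be arbitrary, and let $\{z_i^k\}_{k\ge 0}$ and $\{v_i^k\}_{k\ge 1}$, $i=1,\dots,N$, be generated by the (exact) Proximal-Correction Algorithm (defined in the context). Then all the sequences $\{z_i^k\}_{k\ge0}$, $i=1,\dots,N$, converge to the same point $z^\infty\in\mathbb{R}^n$, which is a solution of $\mathbf 0\in\sum_{i=1}^N T_i(z)$; and for each $i=1,\dots,N$ the sequence $\{v_i^k\}$ converges to an element of $T_i(z^\infty)$.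
   Context: Problem: $\mathcal G=(\mathcal V,\mathcal E)$ is a connected undirected graph with vertex set $\mathcal V=\{1,\dots,N\}$. The problem is to find $z\in\mathbb{R}^n$ with $\mathbf 0\in\sum_{i=1}^N T_i(z)$, where $T_i:\mathbb{R}^n\rightrightarrows\mathbb{R}^n$. Notation: $D(T)=\{x:T(x)\ne\emptyset\}$ is the effective domain; $\mathbf 1$ is the all-ones vector; $A\succ 0$ ($A\succcurlyeq 0$) means $A$ is symmetric positive definite (semidefinite), and $B\succcurlyeq A$ means $B-A\succcurlyeq 0$. Assumption 1: (a) each $T_i$ is maximal monotone; (b) $\left(\bigcap_{i=1}^{N-1}D(T_i)\right)\cap\mathrm{int}(D(T_N))\ne\emptyset$; (c) the problem $\mathbf 0\in\sum_{i=1}^N T_i(z)$ has at least one solution. Assumption 2: $W=[w_{ij}]$ and $\tilde W=[\tilde w_{ij}]$ in $\mathbb{R}^{N\times N}$ satisfy: (a) if $i\neq j$ and $(i,j)\notin\mathcal E$ then $w_{ij}=\tilde w_{ij}=0$; (b) $W\mathbf 1=\mathbf 1$, $\mathbf 1^\top W=\mathbf 1^\top$, $\tilde W\mathbf 1=\mathbf 1$, $\mathbf 1^\top\tilde W=\mathbf 1^\top$; (c) $\mathrm{null}\{\tilde W-W\}=\mathrm{span}\{\mathbf 1\}$ and $\mathrm{null}\{I-\tilde W\}\supseteq\mathrm{span}\{\mathbf 1\}$; (d) $\tilde W\succ 0$ and $(I+W)/2\succcurlyeq\tilde W\succcurlyeq W$. Proximal mapping: for a maximal monotone operator $S$ and $\alpha>0$,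 $\mathrm{prox}_{\alpha S}=(I+\alpha S)^{-1}$, which is single-valued and everywhere defined. Proximal-Correction Algorithm (exact): given $\alpha>0$ and $z_i^0\in\mathbb{R}^n$, set for every $i=1,\dots,N$ $$z_i^1=\mathrm{prox}_{\alpha T_i}\Big(\sum_{j=1}^N w_{ij}z_j^0\Big),\qquad v_i^1=\frac1\alpha\Big(\sum_{j=1}^N w_{ij}z_j^0-z_i^1\Big),$$ and for $k=0,1,2,\dots$ $$z_i^{k+2}=\mathrm{prox}_{\alpha T_i}\Big(z_i^{k+1}+\sum_{j=1}^N w_{ij}z_j^{k+1}-\sum_{j=1}^N\tilde w_{ij}z_j^k+\alpha v_i^{k+1}\Big),$$ $$v_i^{k+2}=\frac1\alpha\Big(z_i^{k+1}+\sum_{j=1}^N w_{ij}z_j^{k+1}-\sum_{j=1}^N\tilde w_{ij}z_j^k-z_i^{k+2}+\alpha v_i^{k+1}\Big).$$ *)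

(* Defs.v *)
From HB Require Import structures.
From mathcomp Require Import all_boot all_order all_algebra.
From mathcomp Require Import all_classical all_reals all_analysis.

Set Implicit Arguments.
Unset Strict Implicit.
Unset Printing Implicit Defensive.

Import Order.TTheory GRing.Theory Num.Theory.
Import numFieldNormedType.Exports.

Local Open Scope classical_set_scope.
Local Open Scope ring_scope.

Section SetValuedOperators.
Context {R : realType} {n : nat}.
Local Notation E := 'rV[R]_n.

Definition inner (x y : E) : R := \sum_(j < n) x 0 j * y 0 j.

(* T : E -> set E is a point-to-set operator; T x u reads "u is in T(x)". *)
Definition effective_domain (T : E -> set E) : set E := [set x | T x !=set0].

Definition monotone_op (T : E -> set E) : Prop :=
  forall x y u v : E, T x u -> T y v -> 0 <= inner (x - y) (u - v).

Definition maximal_monotone (T : E -> set E) : Prop :=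
  monotone_op T /\
  forall S : E -> set E, monotone_op S ->
    (forall x, T x `<=` S x) -> forall x, S x = T x.

Definition inverse_op (T : E -> set E) : E -> set E := fun y => [set x | T x y].

(* (I + alpha S)^-1 as an operator; for S maximal monotone and alpha > 0 its
   values are singletons, so that "z = prox_{alpha S}(y)" is [prox alpha S y z]. *)
Definition prox (alpha : R) (S : E -> set E) : E -> set E :=
  inverse_op (fun z => [set z + alpha *: u | u in S z]).

Definition sum_op {I : finType} (T : I -> E -> set E) : E -> set E :=
  fun z => [set \sum_i u i | u in [set u : I -> E | forall i, T i z (u i)]].

End SetValuedOperators.

Section Matrices.
Context {R : realType} {N : nat}.

Definition psdmx (A : 'M[R]_N) : Prop :=
  A^T = A /\ forall x : 'cV[R]_N, 0 <= (x^T *m A *m x) 0 0.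

Definition pdmx (A : 'M[R]_N) : Prop :=
  A^T = A /\ forall x : 'cV[R]_N, x != 0 -> 0 < (x^T *m A *m x) 0 0.

Definition null_space (A : 'M[R]_N) : set 'cV[R]_N := [set x | A *m x = 0].

Definition ones : 'cV[R]_N := const_mx 1.

Definition span_ones : set 'cV[R]_N := range (fun c : R => c *: ones).

End Matrices.

Definition connected_undirected_graph {V : finType} (e : rel V) : Prop :=
  symmetric e /\ forall i j : V, connect e i j.

(* The N = m.+1 >= 1 vertices are the elements of 'I_m.+1; the last one, which
   has a special role in [op_qualification], is [ord_max]. *)
Record operator_assumption {R : realType} {m n : nat}
    (T : 'I_m.+1 -> 'rV[R]_n -> set 'rV[R]_n) : Prop := OperatorAssumption {
  op_maximal : forall i, maximal_monotone (T i);
  op_qualification :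
    (\bigcap_(i in [set i : 'I_m.+1 | i != ord_max]) effective_domain (T i))
      `&` interior (effective_domain (T ord_max)) !=set0;
  op_solvable : exists z, sum_op T z 0 }.

Record mixing_assumption {R : realType} {N : nat} (e : rel 'I_N)
    (W Wt : 'M[R]_N) : Prop := MixingAssumption {
  mix_sparse : forall i j, i != j -> ~~ e i j -> W i j = 0 /\ Wt i j = 0;
  mix_W_row : W *m ones = ones;
  mix_W_col : ones^T *m W = ones^T;
  mix_Wt_row : Wt *m ones = ones;
  mix_Wt_col : ones^T *m Wt = ones^T;
  mix_null_diff : null_space (Wt - W) = span_ones;
  mix_null_id : span_ones `<=` null_space (1%:M - Wt);
  mix_pd : pdmx Wt;
  mix_upper : psdmx (2^-1 *: (1%:M + W) - Wt);
  mix_lower : psdmx (Wt - W) }.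

(* [z k i] and [v k i] are z_i^k and v_i^k; v_i^k is only defined for k >= 1,
   and [v 0] is unconstrained. *)
Record proximal_correction {R : realType} {N n : nat}
    (T : 'I_N -> 'rV[R]_n -> set 'rV[R]_n) (W Wt : 'M[R]_N) (alpha : R)
    (z v : nat -> 'I_N -> 'rV[R]_n) : Prop := ProximalCorrection {
  pc_z1 : forall i, prox alpha (T i) (\sum_j W i j *: z 0%N j) (z 1%N i);
  pc_v1 : forall i,
    v 1%N i = alpha^-1 *: (\sum_j W i j *: z 0%N j - z 1%N i);
  pc_zS : forall k i,
    prox alpha (T i)
      (z k.+1 i + \sum_j W i j *: z k.+1 j - \sum_j Wt i j *: z k j
       + alpha *: v k.+1 i)
      (z k.+2 i);
  pc_vS : forall k i,
    v k.+2 i = alpha^-1 *: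
      (z k.+1 i + \sum_j W i j *: z k.+1 j - \sum_j Wt i j *: z k j
       - z k.+2 i + alpha *: v k.+1 i) }.

(* Main.v *)
(* Stack the iterates into matrices Z_k, V_k with N rows and put
   P_k = Z_0 + ... + Z_k, A = Wt - W and H = (I + W)/2 - Wt.  The recursion
   telescopes to  alpha V_(k+1) = Wt Z_k - Z_(k+1) - A P_k.  If every row of Zs
   is a solution x, the rows of Vs are elements of the T_i(x) with zero sum, and
   A Ps = - alpha Vs (solvable since range A is orthogonal to the ones vector),
   then monotonicity makes
     |Z_k - Zs|^2_Wt + |P_k - Ps|^2_A
   nonincreasing, with decrease at least |Z_(k+1) - Z_k|^2_Wt + |Z_(k+1)|^2_A.
   Hence all sequences are bounded and every cluster point of (Z_k, V_(k+1)) is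
   again such a pair (Zs, Vs); for that pair the energy tends to 0 along a
   finer filter, hence, being monotone, along the whole sequence. *)

Require Import Defs.
From HB Require Import structures.
From mathcomp Require Import all_boot all_order all_algebra.
From mathcomp Require Import all_classical all_reals all_analysis.
From mathcomp Require Import ring lra.
Import Order.TTheory GRing.Theory Num.Theory.
Import numFieldNormedType.Exports.
Local Open Scope classical_set_scope.
Local Open Scope ring_scope.

(** * Entrywise limits of matrices along a filter *)

Section MatrixConvergence.
Set Implicit Arguments.
Unset Strict Implicit.
Context {R : realType}.

Lemma cvg_mxP {I : Type} {F : set_system I} {FF : Filter F} (p q : nat)
    (X : I -> 'M[R]_(p, q)) (L : 'M[R]_(p, q)) :
  X @ F --> L <-> forall i j, X k i j @[k --> F] --> L i j.
Proof.
split=> [XL i j|XL].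
  by apply: (cvg_comp X (fun M : 'M[R]_(p, q) => M i j) XL); exact: coord_continuous.
move=> B [P LP sPB]; rewrite /nbhs /=.
have : \forall k \near F, forall ij : 'I_p * 'I_q, P ij.1 ij.2 (X k ij.1 ij.2).
  by apply: filter_forall => -[i j]; apply: (XL i j); exact: LP.
by apply: filterS => k PX; apply: sPB => i j; exact: (PX (i, j)).
Qed.

Lemma cvg_mxD {I : Type} {F : set_system I} {FF : Filter F} (p q : nat)
    (X Y : I -> 'M[R]_(p, q)) (L M : 'M[R]_(p, q)) :
  X @ F --> L -> Y @ F --> M -> (fun k => X k + Y k) @ F --> L + M.
Proof.
move=> /cvg_mxP XL /cvg_mxP YM; apply/cvg_mxP => i j.
rewrite mxE (_ : (fun k => _) = (fun k => X k i j + Y k i j)); last first.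
  by apply/funext => k; rewrite mxE.
exact: cvgD.
Qed.

Lemma cvg_mxZ {I : Type} {F : set_system I} {FF : Filter F} (p q : nat) (a : R)
    (X : I -> 'M[R]_(p, q)) (L : 'M[R]_(p, q)) :
  X @ F --> L -> (fun k => a *: X k) @ F --> a *: L.
Proof.
move=> /cvg_mxP XL; apply/cvg_mxP => i j.
rewrite mxE (_ : (fun k => _) = (fun k => a * X k i j)); last first.
  by apply/funext => k; rewrite mxE.
exact: cvgMl_tmp.
Qed.

Lemma cvg_mxB {I : Type} {F : set_system I} {FF : Filter F} (p q : nat)
    (X Y : I -> 'M[R]_(p, q)) (L M : 'M[R]_(p, q)) :
  X @ F --> L -> Y @ F --> M -> (fun k => X k - Y k) @ F --> L - M.
Proof.
move=> XL /(cvg_mxZ (a := -1)) YM; rewrite -[- M]scaleN1r.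
under eq_fun do rewrite -[- Y _]scaleN1r.
exact: cvg_mxD.
Qed.

Lemma cvg_mulmx {I : Type} {F : set_system I} {FF : Filter F} (p q r : nat)
    (X : I -> 'M[R]_(p, q)) (Y : I -> 'M[R]_(q, r))
    (L : 'M[R]_(p, q)) (M : 'M[R]_(q, r)) :
  X @ F --> L -> Y @ F --> M -> (fun k => X k *m Y k) @ F --> L *m M.
Proof.
move=> /cvg_mxP XL /cvg_mxP YM; apply/cvg_mxP => i j.
rewrite mxE (_ : (fun k => _) = (fun k => \sum_l X k i l * Y k l j)); last first.
  by apply/funext => k; rewrite mxE.
by apply: cvg_big => [|l _]; [exact: add_continuous | exact: cvgM].
Qed.

Lemma cvg_trmx {I : Type} {F : set_system I} {FF : Filter F} (p q : nat)
    (X : I -> 'M[R]_(p, q)) (L : 'M[R]_(p, q)) :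
  X @ F --> L -> (fun k => (X k)^T) @ F --> L^T.
Proof.
move=> /cvg_mxP XL; apply/cvg_mxP => i j; rewrite mxE.
by under eq_fun do rewrite mxE; exact: XL.
Qed.

Lemma cvg_mxtrace {I : Type} {F : set_system I} {FF : Filter F} (p : nat)
    (X : I -> 'M[R]_p) (L : 'M[R]_p) :
  X @ F --> L -> \tr (X k) @[k --> F] --> \tr L.
Proof.
move=> /cvg_mxP XL.
by apply: cvg_big => [|l _]; [exact: add_continuous | exact: XL].
Qed.

Lemma cvg_mx_unique {I : Type} {F : set_system I} {FF : ProperFilter F}
    (p q : nat) (X : I -> 'M[R]_(p, q)) (L M : 'M[R]_(p, q)) :
  X @ F --> L -> X @ F --> M -> L = M.
Proof.
move=> /cvg_mxP XL /cvg_mxP XM; apply/matrixP => i j.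
exact: (cvg_unique _ (XL i j) (XM i j)).
Qed.

(* Cluster points are handled through an ultrafilter: along it every bounded
   sequence converges, so no subsequence has to be extracted. *)
Lemma ultra_bounded_mx_cvg {I : Type} {F : set_system I} {UF : UltraFilter F}
    (p q : nat) (X : I -> 'M[R]_(p, q)) (b : 'I_p -> 'I_q -> R) :
  (forall k i j, `|X k i j| <= b i j) -> exists L : 'M[R]_(p, q), X @ F --> L.
Proof.
move=> Xb.
have Xl i j : exists l : R, X k i j @[k --> F] --> l.
  have := @segment_compact R (- b i j) (b i j); rewrite compact_ultra /=.
  set f := fun k => X k i j.
  move=> /(_ (f @ F)) [||l [_ fl]]; last by exists l.
    (* The image of an ultrafilter is an ultrafilter: if [A] is in a finer [G] but its preimage is
       not in [F], then [G] also contains the complement of [A]. *)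
    split=> [|G GF sFG]; first exact: fmap_proper_filter.
    apply/seteqP; split=> // A GA.
    have [//|FnA] := in_ultra_setVsetC (f @^-1` A) UF.
    have GnA : G (~` A) by exact: sFG.
    by have [y []] := filter_ex (filterI GA GnA).
  by apply: (@filterE _ F) => k /=; rewrite in_itv /= -ler_norml; exact: Xb.
pose L := \matrix_(i, j) projT1 (cid (Xl i j)).
exists L; apply/cvg_mxP => i j; rewrite mxE; exact: (projT2 (cid (Xl i j))).
Qed.
End MatrixConvergence.

(** * Trace forms and the entry bounds they give by Cauchy-Schwarz *)

Section QuadraticForms.
Set Implicit Arguments.
Unset Strict Implicit.
Context {R : realType} {N n : nat}.
Implicit Types (A B : 'M[R]_N) (X Y : 'M[R]_(N, n)).

(** The bilinear form of [A] summed over columns; for [A] positive semidefinite, [trform A X X] is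
    the squared seminorm |X|_A^2. *)
Definition trform A X Y : R := \tr (X^T *m A *m Y).

Lemma trformDl A X1 X2 Y : trform A (X1 + X2) Y = trform A X1 Y + trform A X2 Y.
Proof. by rewrite /trform linearD !mulmxDl linearD. Qed.

Lemma trformDr A X Y1 Y2 : trform A X (Y1 + Y2) = trform A X Y1 + trform A X Y2.
Proof. by rewrite /trform mulmxDr linearD. Qed.

Lemma trformZl A a X Y : trform A (a *: X) Y = a * trform A X Y.
Proof. by rewrite /trform linearZ -!scalemxAl mxtraceZ. Qed.

Lemma trformZr A a X Y : trform A X (a *: Y) = a * trform A X Y.
Proof. by rewrite /trform -scalemxAr mxtraceZ. Qed.

Lemma trformNl A X Y : trform A (- X) Y = - trform A X Y.
Proof. by rewrite -scaleN1r trformZl mulN1r. Qed.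

Lemma trformNr A X Y : trform A X (- Y) = - trform A X Y.
Proof. by rewrite -scaleN1r trformZr mulN1r. Qed.

Lemma trform_mxD A B X Y : trform (A + B) X Y = trform A X Y + trform B X Y.
Proof. by rewrite /trform mulmxDr mulmxDl linearD. Qed.

Lemma trform_mxZ a A X Y : trform (a *: A) X Y = a * trform A X Y.
Proof. by rewrite /trform -scalemxAr -scalemxAl mxtraceZ. Qed.

Lemma trform_sym A X Y : A^T = A -> trform A X Y = trform A Y X.
Proof.
by move=> sA; rewrite /trform -mxtrace_tr !trmx_mul trmxK sA mulmxA.
Qed.

Lemma trform_diag A X : trform A X X = \sum_j ((col j X)^T *m A *m col j X) 0 0.
Proof.
apply: eq_bigr => j _.
by rewrite tr_col -row_mul !mxE; apply: eq_bigr => i _; rewrite !mxE.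
Qed.

Lemma trform_ge0 A X : psdmx A -> 0 <= trform A X X.
Proof. by move=> [_ A0]; rewrite trform_diag; apply: sumr_ge0 => j _. Qed.

Lemma trform_cauchy_schwarz A X Y :
  psdmx A -> trform A X Y ^+ 2 <= trform A X X * trform A Y Y.
Proof.
move=> pA; have [sA _] := pA.
have quad t : 0 <= trform A X X + 2 * t * trform A X Y + t ^+ 2 * trform A Y Y.
  have := trform_ge0 (X + t *: Y) pA.
  rewrite !(trformDl, trformDr, trformZl, trformZr) (trform_sym Y X sA).
  by congr (0 <= _); ring.
move: quad (trform_ge0 Y pA).
set a := trform A X X; set b := trform A X Y; set c := trform A Y Y => quad.
rewrite le_eqVlt => /predU1P[c0|c_gt0].
  rewrite -c0 mulr0; have [->|b0] := eqVneq b 0; first by rewrite expr0n.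
  (* When [c = 0] the polynomial |X + tY|_A^2 is affine in t, and this t would give it the value
     -1. *)
  have := quad (- (a + 1) / (2 * b)); rewrite -c0 mulr0 addr0.
  have -> : 2 * (- (a + 1) / (2 * b)) * b = - (a + 1) by field.
  lra.
(* The value t = -b/c minimises the polynomial. *)
have := mulr_ge0 (ltW c_gt0) (quad (- b / c)).
have -> : c * (a + 2 * (- b / c) * b + (- b / c) ^+ 2 * c) = a * c - b ^+ 2.
  by field; rewrite gt_eqF.
by rewrite subr_ge0.
Qed.

Lemma pdmx_psd A : pdmx A -> psdmx A.
Proof.
move=> [sA A0]; split=> // x; have [->|/A0/ltW//] := eqVneq x 0.
by rewrite mulmx0 mxE.
Qed.

Lemma pdmx_unit A : pdmx A -> A \in unitmx.
Proof.
move=> [sA A0]; rewrite -row_free_unit -kermx_eq0; apply/eqP/row_matrixP => i.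
rewrite row0; apply/eqP; apply: contraT => x0.
have /A0 : (row i (kermx A))^T != 0 by rewrite trmx_eq0.
by rewrite trmxK -row_mul mulmx_ker row0 mul0mx mxE ltxx.
Qed.

Lemma trform_delta A X i j : trform A (delta_mx i j) X = (A *m X) i j.
Proof.
rewrite /trform trmx_delta -mulmxA -(mul_delta_mx (0 : 'I_1)) -mulmxA -rowE.
by rewrite mxtrace_mulC -colE trace_mx11 !mxE.
Qed.

Lemma trform_delta_delta A i j : trform A (delta_mx i j) (delta_mx i j) = A i i.
Proof.
rewrite trform_delta mxE (bigD1 i) //= big1 ?addr0 => [|l li]; rewrite mxE.
  by rewrite !eqxx mulr1.
by rewrite (negPf li) mulr0.
Qed.

(** Cauchy-Schwarz against [delta_mx i j]. A semidefinite form may vanish at a nonzero [X], so only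
    [A *m X] is controlled. *)
Lemma psdmx_mul_entry_le A X i j :
  psdmx A -> (A *m X) i j ^+ 2 <= A i i * trform A X X.
Proof.
move=> pA; rewrite -trform_delta -(trform_delta_delta A i j).
exact: trform_cauchy_schwarz.
Qed.

(** Cauchy-Schwarz against [invmx A *m delta_mx i j], which represents the entry functional for the
    form and has squared norm [invmx A i i]. *)
Lemma pdmx_entry_le A X i j :
  pdmx A -> X i j ^+ 2 <= invmx A i i * trform A X X.
Proof.
move=> pA; have [sA _] := pA; have uA := pdmx_unit pA.
have -> : X i j = trform A (invmx A *m delta_mx i j) X.
  rewrite -[X in LHS]mul1mx -trform_delta /trform trmx_mul trmx_inv sA.
  by rewrite mulmx1 mulmxKV.
have -> : invmx A i i =
    trform A (invmx A *m delta_mx i j) (invmx A *m delta_mx i j).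
  rewrite -(trform_delta_delta _ i j) /trform trmx_mul trmx_inv sA.
  by rewrite mulmxKV // mulmxA.
exact/trform_cauchy_schwarz/pdmx_psd.
Qed.

Lemma psdmx_diag_ge0 A i : psdmx A -> 0 <= A i i.
Proof.
move=> [_ /(_ (delta_mx i 0))].
by rewrite trmx_delta -rowE -colE !mxE.
Qed.

Lemma pdmx_invmx_psd A : pdmx A -> psdmx (invmx A).
Proof.
move=> pA; have [sA A0] := pdmx_psd pA; have uA := pdmx_unit pA.
split=> [|x]; first by rewrite trmx_inv sA.
have := A0 (invmx A *m x).
by rewrite trmx_mul trmx_inv sA mulmxKV // mulmxA.
Qed.

(** Since [A *m pinvmx A *m A = A], the seminorm sees [X] only through [A *m X], so it passes to the
    limit as soon as [A *m X] converges. *)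
Lemma trform_pinvmx A X :
  A^T = A -> trform A X X = trform (pinvmx A) (A *m X) (A *m X).
Proof.
move=> sA; rewrite -[in LHS](mulmxKpV (submx_refl A)).
by rewrite /trform trmx_mul sA !mulmxA.
Qed.

End QuadraticForms.

(** * Closed graphs of maximal monotone operators; matrices whose kernel is spanned by the ones
    vector *)

Section Preliminaries.
Set Implicit Arguments.
Unset Strict Implicit.
Context {R : realType}.

Lemma cvg_trform {I : Type} {F : set_system I} {FF : Filter F} (N n : nat)
    (A : 'M[R]_N) (X : I -> 'M[R]_(N, n)) (L : 'M[R]_(N, n)) :
  X @ F --> L -> trform A (X k) (X k) @[k --> F] --> trform A L L.
Proof.
move=> XL; apply: cvg_mxtrace; apply: cvg_mulmx => //.
by apply: cvg_mulmx; [exact: cvg_trmx | exact: cvg_cst].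
Qed.

Lemma cvg_mx0_sqr {I : Type} {F : set_system I} {FF : Filter F} (p q : nat)
    (X : I -> 'M[R]_(p, q)) (u : I -> R) (c : 'I_p -> R) :
  (forall k i j, X k i j ^+ 2 <= c i * u k) -> u @ F --> 0 -> X @ F --> (0 : 'M[R]_(p, q)).
Proof.
move=> Xu u0; apply/cvg_mxP => i j; rewrite mxE.
have X2 : (X k i j) ^+ 2 @[k --> F] --> (0 : R).
  apply: (@squeeze_cvgr _ _ _ _ (fun=> 0) (fun k => c i * u k)).
  - by apply: nearW => k; rewrite sqr_ge0 Xu.
  - exact: cvg_cst.
  - by rewrite -[0 in X in _ --> X](mulr0 (c i)); exact: cvgMl_tmp.
apply/norm_cvg0P.
under eq_fun do rewrite -sqrtr_sqr.
by have := cvg_comp _ _ X2 (@sqrt_continuous R 0); rewrite sqrtr0.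
Qed.

Lemma sqr_le_norm_le (a b : R) : a ^+ 2 <= b -> `|a| <= 1 + b.
Proof.
move=> ab; rewrite ler_norml; apply/andP; split; nra.
Qed.

(** The monotonicity inequalities against any fixed point of the graph survive the limit, so adding
    [(a, b)] to the graph keeps it monotone; maximality then says it was already there. *)
Lemma maximal_monotone_closed {I : Type} {F : set_system I} {PF : ProperFilter F}
    (n : nat) (T : 'rV[R]_n -> set 'rV[R]_n) (x u : I -> 'rV[R]_n) (a b : 'rV[R]_n) :
  maximal_monotone T -> (forall k, T (x k) (u k)) ->
  x @ F --> a -> u @ F --> b -> T a b.
Proof.
move=> [monT maxT] Txu xa ub.
have innerE (y z : 'rV[R]_n) : inner y z = \tr (y *m z^T).
  by rewrite trace_mx11 mxE; apply: eq_bigr => j _; rewrite mxE.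
have Tab y w : T y w -> 0 <= inner (a - y) (b - w).
  move=> Tyw; rewrite innerE.
  have cv : \tr ((x k - y) *m (u k - w)^T) @[k --> F] --> \tr ((a - y) *m (b - w)^T).
    apply: cvg_mxtrace; apply: cvg_mulmx; last apply: cvg_trmx.
      by apply: cvg_mxB => //; exact: cvg_cst.
    by apply: cvg_mxB => //; exact: cvg_cst.
  apply: (cvgr_to_ge cv); apply: nearW => k; rewrite -innerE.
  exact: monT.
pose S y := [set w | T y w \/ (y = a /\ w = b)].
have inner_swap (y z y' z' : 'rV[R]_n) : inner (y - y') (z - z') = inner (y' - y) (z' - z).
  by rewrite -(opprB y' y) -(opprB z' z) !innerE linearN mulNmx mulmxN opprK.
rewrite -(maxT S) => [|y z v w|y w Tyw]; first by right.
- case=> [Tyv [Tzw|[-> ->]]|[-> ->] [Tzw|[-> ->]]].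
  + exact: monT.
  + by rewrite inner_swap; exact: Tab.
  + exact: Tab.
  + by rewrite !subrr innerE mul0mx linear0.
- by left.
Qed.

Lemma prox_mem (n : nat) (alpha : R) (T : 'rV[R]_n -> set 'rV[R]_n) y z :
  0 < alpha -> prox alpha T y z -> T z (alpha^-1 *: (y - z)).
Proof.
move=> a0 [u Tzu <-].
by rewrite addrC addKr scalerA mulVf ?scale1r // gt_eqF.
Qed.

(** Each column of [X] lies in the kernel. The product [ones *m x] has all rows equal to [x]: it
    encodes consensus at [x]. *)
Lemma null_ones_colspan (N n : nat) (A : 'M[R]_N) (X : 'M[R]_(N, n)) :
  null_space A = span_ones -> A *m X = 0 -> exists x : 'rV[R]_n, X = ones *m x.
Proof.
move=> nA AX0.
have colX j : exists c : R, col j X = c *: ones.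
  have : null_space A (col j X) by rewrite /null_space /= colE mulmxA AX0 mul0mx.
  by rewrite nA => -[c _ <-]; exists c.
exists (\row_j projT1 (cid (colX j))); apply/matrixP => i j.
have /matrixP/(_ i 0) := projT2 (cid (colX j)).
by rewrite !mxE big_ord1 !mxE mulr1 mul1r.
Qed.

(** The columns of [cokermx A] are killed by [A], hence multiples of [ones], so [U^T] annihilates
    them and lies in the row space of [A]; symmetry turns rows into columns. *)
Lemma range_ones_orthogonal (N n : nat) (A : 'M[R]_N) (U : 'M[R]_(N, n)) :
  A^T = A -> null_space A = span_ones -> ones^T *m U = 0 -> exists P, A *m P = U.
Proof.
move=> sA nA U0.
have [x cokA] := null_ones_colspan nA (mulmx_coker A).
have /submxP[D UD] : (U^T <= A)%MS.
  by rewrite submxE cokA mulmxA -[ones]trmxK -trmx_mul U0 trmx0 mul0mx.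
by exists D^T; rewrite -[U]trmxK UD trmx_mul sA.
Qed.

End Preliminaries.

(** * The iteration in matrix form *)

Section Dynamics.
Set Implicit Arguments.
Unset Strict Implicit.
Context {R : realType} {m n : nat} (e : rel 'I_m.+1)
  (T : 'I_m.+1 -> 'rV[R]_n -> set 'rV[R]_n) (W Wt : 'M[R]_m.+1) (alpha : R)
  (z v : nat -> 'I_m.+1 -> 'rV[R]_n).
Hypothesis maxT : forall i, maximal_monotone (T i).
Hypothesis mix : mixing_assumption e W Wt.
Hypothesis alpha_gt0 : 0 < alpha.
Hypothesis pc : proximal_correction T W Wt alpha z v.

Let Z k : 'M[R]_(m.+1, n) := \matrix_i z k i.
Let V k : 'M[R]_(m.+1, n) := \matrix_i v k i.
Let P k : 'M[R]_(m.+1, n) := \sum_(0 <= t < k.+1) Z t.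
Let A : 'M[R]_m.+1 := Wt - W.
Let H : 'M[R]_m.+1 := 2^-1 *: (1%:M + W) - Wt.

Lemma P_succ k : P k.+1 = P k + Z k.+1.
Proof. by rewrite /P big_nat_recr. Qed.

(** With y the argument of the proximal map, v is the residual (y - z) / alpha, the element of
    T_i(z) that the resolvent selects. *)
Lemma iterates_in_graph k i : T i (z k.+1 i) (v k.+1 i).
Proof.
case: k => [|k].
  by rewrite (pc_v1 pc); apply: prox_mem => //; exact: pc_z1 pc i.
have := prox_mem alpha_gt0 (pc_zS pc k i).
by rewrite (pc_vS pc) (addrAC _ (alpha *: _)).
Qed.

Lemma mulmx_rowsE (B : 'M[R]_m.+1) k i : \sum_j B i j *: z k j = row i (B *m Z k).
Proof.
by rewrite row_mul mulmx_sum_row; apply: eq_bigr => j _; rewrite mxE rowK.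
Qed.

Lemma recurrence k : alpha *: V k.+1 = Wt *m Z k - Z k.+1 - A *m P k.
Proof.
have alpha0 : alpha != 0 by rewrite gt_eqF.
elim: k => [|k IHk].
  have -> : alpha *: V 1 = W *m Z 0 - Z 1.
    apply/row_matrixP => i; rewrite linearZ /= linearB /= !rowK (pc_v1 pc).
    by rewrite scalerA mulfV // scale1r mulmx_rowsE.
  (* [P 0 = Z 0] and [W = Wt - A]. *)
  rewrite /P big_nat1 /A mulmxBl; apply/matrixP=> i j; rewrite !mxE; ring.
have -> : alpha *: V k.+2 =
    Z k.+1 + W *m Z k.+1 - Wt *m Z k - Z k.+2 + alpha *: V k.+1.
  apply/row_matrixP => i.
  rewrite !(linearZ, linearD, linearN) /= !rowK (pc_vS pc).
  by rewrite scalerA mulfV // scale1r !mulmx_rowsE.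
rewrite IHk P_succ mulmxDr /A [(Wt - W) *m Z _]mulmxBl.
by apply/matrixP=> i j; rewrite !mxE; ring.
Qed.

Let psdA : psdmx A := mix_lower mix.
Let psdH : psdmx H := mix_upper mix.
Let symA : A^T = A := proj1 psdA.
Let pdWt : pdmx Wt := mix_pd mix.

Lemma A_ones : A *m ones = 0.
Proof. by rewrite mulmxBl (mix_Wt_row mix) (mix_W_row mix) subrr. Qed.

Lemma ones_A : ones^T *m A = 0.
Proof. by rewrite mulmxBr (mix_Wt_col mix) (mix_W_col mix) subrr. Qed.

(** * Primal-dual pairs and the energy inequality *)

Definition primal_dual (x : 'rV[R]_n) (U : 'M[R]_(m.+1, n)) :=
  (forall i, T i x (row i U)) /\ ones^T *m U = 0.

(** [D] stands for Ps; the second term depends on it only through [A *m D], so any preimage of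
    [- alpha *: U] under [A] serves. *)
Definition energy x (D : 'M[R]_(m.+1, n)) k :=
  trform Wt (Z k - ones *m x) (Z k - ones *m x) + trform A (P k - D) (P k - D).

Lemma energy_ge0 x D k : 0 <= energy x D k.
Proof. by apply: addr_ge0; apply: trform_ge0 => //; exact: pdmx_psd. Qed.

(** The identity splits as 2H + Wt + A, three semidefinite parts; this compares the Euclidean term
    produced by the proximal step with the two metrics of the energy. *)
Lemma trform_identity (X Y : 'M[R]_(m.+1, n)) :
  \tr (X^T *m Y) = 2 * trform H X Y + trform Wt X Y + trform A X Y.
Proof.
rewrite -[X^T in LHS]mulmx1 -/(trform 1%:M X Y).
have -> : 1%:M = 2 *: H + Wt + A :> 'M[R]_m.+1.
  by apply/matrixP => i j; rewrite !mxE; field.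
by rewrite (trform_mxD (2 *: H + Wt)) (trform_mxD (2 *: H)) trform_mxZ.
Qed.

Lemma primal_dual_tr_ge0 x U k : primal_dual x U ->
  0 <= \tr ((Z k.+1 - ones *m x)^T *m (V k.+1 - U)).
Proof.
(* After the swap, the diagonal entries are inner products of rows, one monotonicity inequality per
   vertex. *)
move=> [TU _]; rewrite mxtrace_mulC.
apply: sumr_ge0 => i _; have [monT _] := maxT i.
have := monT _ _ _ _ (iterates_in_graph k i) (TU i).
congr (0 <= _); rewrite mxE; apply: eq_bigr => j _.
by rewrite !mxE big_ord1 !mxE mul1r mulrC.
Qed.

(** Subtracting the fixed-point relation from [recurrence] gives [key]. Pairing it with Z_(k+1) - Zs
    is nonnegative by monotonicity; twice this inequality, expanded by polarization, is the claim up
    to the sign of the H term. *)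
Lemma energy_decrease x U D k : primal_dual x U -> A *m D = - alpha *: U ->
  energy x D k.+1 + trform Wt (Z k.+1 - Z k) (Z k.+1 - Z k)
    + trform A (Z k.+1) (Z k.+1) <= energy x D k.
Proof.
move=> pd AD; rewrite /energy.
set zn := Z k.+1 - ones *m x; set zc := Z k - ones *m x; set pD := P k - D.
have -> : Z k.+1 - Z k = zn - zc by rewrite /zn /zc opprB addrA subrK.
have -> : P k.+1 - D = pD + Z k.+1 by rewrite P_succ /pD addrAC.
(* [A] kills the consensus part, so inside [A]-forms Z_(k+1) may be replaced by its error [zn]. *)
have AZ : A *m Z k.+1 = A *m zn by rewrite mulmxBr mulmxA A_ones mul0mx subr0.
have fZ X : trform A X (Z k.+1) = trform A X zn by rewrite /trform -!mulmxA AZ.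
have key : alpha *: (V k.+1 - U) = Wt *m zc - zn - A *m pD.
  have xE : Wt *m (ones *m x) = ones *m x by rewrite mulmxA (mix_Wt_row mix).
  rewrite scalerBr recurrence /zc /pD !mulmxBr xE AD /zn.
  by apply/matrixP=> i j; rewrite !mxE; ring.
have := mulr_ge0 (ltW alpha_gt0) (primal_dual_tr_ge0 k pd); rewrite -/zn.
rewrite -mxtraceZ scalemxAr key.
move: zn zc pD {key} AZ fZ => zn zc pD AZ fZ.
rewrite !mulmxBr !linearB /= (trform_identity zn zn).
rewrite !mulmxA -!/(trform _ _ _).
have sWt := proj1 pdWt.
rewrite !(trformDl, trformDr, trformNl, trformNr) !fZ.
rewrite (trform_sym (Z k.+1) pD symA) (trform_sym (Z k.+1) zn symA) !fZ.
rewrite (trform_sym zc zn sWt) (trform_sym pD zn symA).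
have := trform_ge0 zn psdH.
set a := trform H zn zn; set b := trform Wt zn zn; set c := trform A zn zn.
set d := trform Wt zn zc; set f := trform A zn pD.
lra.
Qed.

Lemma energy_nonincreasing x U D : primal_dual x U -> A *m D = - alpha *: U ->
  nonincreasing_seq (energy x D).
Proof.
move=> pd AD; apply/nonincreasing_seqP => k.
have := energy_decrease k pd AD.
have := trform_ge0 (Z k.+1 - Z k) (pdmx_psd pdWt).
have := trform_ge0 (Z k.+1) psdA.
lra.
Qed.

Lemma energy_cvg x U D : primal_dual x U -> A *m D = - alpha *: U ->
  cvgn (energy x D).
Proof.
move=> pd AD; apply: nonincreasing_is_cvgn; first exact: energy_nonincreasing pd AD.
by exists 0 => _ [k _ <-]; exact: energy_ge0.
Qed.

Lemma dual_preimage x U : primal_dual x U -> exists D, A *m D = - alpha *: U.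
Proof.
move=> [_ U0]; apply: range_ones_orthogonal => //.
  exact: mix_null_diff mix.
by rewrite -scalemxAr U0 scaler0.
Qed.

(** * Vanishing increments and boundedness *)

Lemma asymptotic_regularity x U : primal_dual x U ->
  (fun k => Z k.+1 - Z k) @ \oo --> (0 : 'M[R]_(m.+1, n)) /\
  (fun k => A *m Z k.+1) @ \oo --> (0 : 'M[R]_(m.+1, n)).
Proof.
move=> pd; have [D AD] := dual_preimage pd.
(* The energy drops tend to 0 because the energy converges, and they dominate both squared seminorms
   in [energy_decrease]. *)
pose u k := energy x D k - energy x D k.+1.
have u0 : u @ \oo --> (0 : R).
  have cE := energy_cvg pd AD.
  rewrite -(subrr (limn (energy x D))); apply: cvgB => //.
  by rewrite cvg_shiftS.
have fWt k := trform_ge0 (Z k.+1 - Z k) (pdmx_psd pdWt).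
have fA k := trform_ge0 (Z k.+1) psdA.
split.
  apply: (cvg_mx0_sqr (u := u) (c := fun i => invmx Wt i i)) => // k i j.
  apply: le_trans (pdmx_entry_le _ i j pdWt) _.
  apply: ler_wpM2l; first exact/psdmx_diag_ge0/pdmx_invmx_psd.
  have := energy_decrease k pd AD; rewrite /u; have := fA k; lra.
apply: (cvg_mx0_sqr (u := u) (c := fun i => A i i)) => // k i j.
apply: le_trans (psdmx_mul_entry_le _ i j psdA) _.
apply: ler_wpM2l; first exact: psdmx_diag_ge0.
have := energy_decrease k pd AD; rewrite /u; have := fWt k; lra.
Qed.

Lemma Z_bounded x U : primal_dual x U ->
  exists b : 'I_m.+1 -> 'I_n -> R, forall k i j, `|Z k i j| <= b i j.
Proof.
move=> pd; have [D AD] := dual_preimage pd.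
exists (fun i j => `|x 0 j| + (1 + invmx Wt i i * energy x D 0)) => k i j.
have -> : Z k i j = x 0 j + (Z k - ones *m x) i j.
  by rewrite !mxE big_ord1 !mxE mul1r addrCA subrr addr0.
apply: le_trans (ler_normD _ _) _; rewrite lerD2l; apply: sqr_le_norm_le.
apply: le_trans (pdmx_entry_le _ i j pdWt) _.
apply: ler_wpM2l; first exact/psdmx_diag_ge0/pdmx_invmx_psd.
apply: le_trans (energy_nonincreasing pd AD (leq0n k)).
by rewrite lerDl trform_ge0.
Qed.

(** The energy ignores any drift of the sums [P k] along [ones], so the bound concerns [A *m P k]
    only. *)
Lemma mulmx_A_P_bounded x U : primal_dual x U ->
  exists b : 'I_m.+1 -> 'I_n -> R, forall k i j, `|(A *m P k) i j| <= b i j.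
Proof.
move=> pd; have [D AD] := dual_preimage pd.
exists (fun i j => `|(A *m D) i j| + (1 + A i i * energy x D 0)) => k i j.
have -> : (A *m P k) i j = (A *m D) i j + (A *m (P k - D)) i j.
  by rewrite -[in LHS](subrK (A *m D) (A *m P k)) mulmxBr mxE addrC.
apply: le_trans (ler_normD _ _) _; rewrite lerD2l; apply: sqr_le_norm_le.
apply: le_trans (psdmx_mul_entry_le _ i j psdA) _.
apply: ler_wpM2l; first exact: psdmx_diag_ge0.
apply: le_trans (energy_nonincreasing pd AD (leq0n k)).
by rewrite lerDr trform_ge0 //; exact: pdmx_psd.
Qed.

(** * Cluster points and convergence of the whole sequence *)

Lemma cluster_primal_dual x0 U0 : primal_dual x0 U0 ->
  exists (G : set_system nat) (x : 'rV[R]_n) (U : 'M[R]_(m.+1, n)),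
  [/\ ProperFilter G, \oo `<=` G, primal_dual x U, Z @ G --> ones *m x
    & (fun k => A *m P k) @ G --> - alpha *: U].
Proof.
move=> pd0; have alpha0 : alpha != 0 by rewrite gt_eqF.
have [dZ AZ] := asymptotic_regularity pd0.
have [bZ Zb] := Z_bounded pd0.
have [bP Pb] := mulmx_A_P_bounded pd0.
have [G [UG ooG]] := @ultraFilterLemma nat \oo _.
have [Zl ZZl] := ultra_bounded_mx_cvg Zb.
have [Q PQ] := ultra_bounded_mx_cvg Pb.
have {}dZ : (fun k => Z k.+1 - Z k) @ G --> (0 : 'M[R]_(m.+1, n)).
  exact: cvg_trans (cvg_app _ ooG) dZ.
have {}AZ : (fun k => A *m Z k.+1) @ G --> (0 : 'M[R]_(m.+1, n)).
  exact: cvg_trans (cvg_app _ ooG) AZ.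
(* An ultrafilter need not be invariant under the index shift; the vanishing increments make the
   shifted sequence have the same limit. *)
have ZSl : (fun k => Z k.+1) @ G --> Zl.
  rewrite -[Zl]add0r (_ : (fun k => _) = (fun k => Z k.+1 - Z k + Z k)).
    exact: cvg_mxD.
  by apply/funext => k; rewrite subrK.
have AZl : A *m Zl = 0.
  apply: cvg_mx_unique AZ; apply: cvg_mulmx ZSl; exact: cvg_cst.
have [x Zlx] := null_ones_colspan (mix_null_diff mix) AZl.
have WtZl : Wt *m Zl = Zl by rewrite Zlx mulmxA (mix_Wt_row mix).
(* Forced by [recurrence] in the limit, where [Wt *m Zl - Zl] vanishes by consensus. *)
pose U := - alpha^-1 *: Q.
have VU : (fun k => V k.+1) @ G --> U.
  have -> : U = alpha^-1 *: (Wt *m Zl - Zl - Q).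
    by rewrite /U WtZl subrr sub0r scalerN scaleNr.
  have -> : (fun k => V k.+1) =
      (fun k => alpha^-1 *: (Wt *m Z k - Z k.+1 - A *m P k)).
    by apply/funext => k; rewrite -recurrence scalerA mulVf ?scale1r.
  apply: cvg_mxZ; apply: cvg_mxB PQ; apply: cvg_mxB ZSl.
  exact: cvg_mulmx (cvg_cst _) ZZl.
have UQ : - alpha *: U = Q by rewrite scalerA mulrNN mulfV // scale1r.
exists G, x, U; split.
- exact: ultra_proper.
- exact: ooG.
- split=> [i|].
    apply: (maximal_monotone_closed (F := G) (x := fun k => z k.+1 i)
      (u := fun k => v k.+1 i)) => //.
    + by move=> k; exact: iterates_in_graph.
    + apply/cvg_mxP => a j; rewrite ord1.
      have /cvg_mxP/(_ i j) := ZSl; rewrite Zlx !mxE big_ord1 !mxE mul1r.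
      by under eq_fun do rewrite mxE.
    + apply/cvg_mxP => a j; rewrite ord1.
      have /cvg_mxP/(_ i j) := VU; rewrite !mxE.
      by under eq_fun do rewrite mxE.
  (* Each [A *m P k] has zero column sums, and the limit inherits this. *)
  have Q0 : ones^T *m Q = 0.
    apply: (cvg_mx_unique (F := G) (X := fun k => ones^T *m (A *m P k))).
      exact: cvg_mulmx (cvg_cst _) PQ.
    under eq_fun do rewrite mulmxA ones_A mul0mx; exact: cvg_cst.
  by rewrite -scalemxAr Q0 scaler0.
- by rewrite -Zlx.
- by rewrite UQ.
Qed.

Lemma sequences_cvg x0 U0 : primal_dual x0 U0 ->
  exists (x : 'rV[R]_n) (U : 'M[R]_(m.+1, n)),
  [/\ primal_dual x U, Z @ \oo --> ones *m x & V @ \oo --> U].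
Proof.
move=> /cluster_primal_dual[G [x [U [PG ooG pd ZG PG']]]].
have alpha0 : alpha != 0 by rewrite gt_eqF.
have [D AD] := dual_preimage pd.
have energyG : energy x D k @[k --> G] --> (0 : R).
  rewrite -(addr0 0); apply: cvgD.
    have -> : 0 = trform Wt 0 (0 : 'M[R]_(m.+1, n)).
      by rewrite /trform mulmx0 linear0.
    apply: cvg_trform; rewrite -(subrr (ones *m x)).
    exact: cvg_mxB ZG (cvg_cst _).
  (* Along [G] only [A *m P k] is known to converge, so the second energy term is rewritten through
     it. *)
  under eq_fun do rewrite trform_pinvmx //.
  have -> : 0 = trform (pinvmx A) 0 (0 : 'M[R]_(m.+1, n)).
    by rewrite /trform mulmx0 linear0.
  apply: cvg_trform; rewrite -(subrr (A *m D)).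
  under eq_fun do rewrite mulmxBr.
  by rewrite -AD in PG'; exact: cvg_mxB PG' (cvg_cst _).
(* By monotonicity the energy has a limit at infinity; [G] is finer, so this limit equals the one
   along [G], which is 0. *)
have energy0 : energy x D @ \oo --> (0 : R).
  have cE := energy_cvg pd AD.
  rewrite -(cvg_unique _ (cvg_trans (cvg_app _ ooG) cE) energyG) //.
have ZX : (fun k => Z k - ones *m x) @ \oo --> (0 : 'M[R]_(m.+1, n)).
  apply: (cvg_mx0_sqr (u := energy x D) (c := fun i => invmx Wt i i)) => // k i j.
  apply: le_trans (pdmx_entry_le _ i j pdWt) _.
  apply: ler_wpM2l; first exact/psdmx_diag_ge0/pdmx_invmx_psd.
  by rewrite lerDl trform_ge0.
have PX : (fun k => A *m P k - A *m D) @ \oo --> (0 : 'M[R]_(m.+1, n)).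
  apply: (cvg_mx0_sqr (u := energy x D) (c := fun i => A i i)) => // k i j.
  rewrite -mulmxBr.
  apply: le_trans (psdmx_mul_entry_le _ i j psdA) _.
  apply: ler_wpM2l; first exact: psdmx_diag_ge0.
  by rewrite lerDr trform_ge0 //; exact: pdmx_psd.
have Zx : Z @ \oo --> ones *m x.
  rewrite -[ones *m x]add0r.
  rewrite (_ : Z = (fun k => (Z k - ones *m x) + ones *m x)); last first.
    by apply/funext => k; rewrite subrK.
  exact: cvg_mxD ZX (cvg_cst _).
have APD : (fun k => A *m P k) @ \oo --> A *m D.
  rewrite -[A *m D]add0r.
  rewrite (_ : (fun k => _) = (fun k => (A *m P k - A *m D) + A *m D)); last first.
    by apply/funext => k; rewrite subrK.
  exact: cvg_mxD PX (cvg_cst _).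
(* [V 0] is unconstrained, so the limit is taken on the shifted sequence, where [recurrence]
   applies. *)
exists x, U; split => //; rewrite -cvg_shiftS.
have -> : U = alpha^-1 *: (Wt *m (ones *m x) - ones *m x - A *m D).
  rewrite mulmxA (mix_Wt_row mix) subrr sub0r AD scaleNr opprK scalerA mulVf //.
  by rewrite scale1r.
rewrite (_ : [sequence V n.+1]_n =
    (fun k => alpha^-1 *: (Wt *m Z k - Z k.+1 - A *m P k))); last first.
  by apply/funext => k; rewrite -recurrence scalerA mulVf ?scale1r.
apply: cvg_mxZ; apply: cvg_mxB APD; apply: cvg_mxB.
  exact: cvg_mulmx (cvg_cst _) Zx.
by move: Zx; rewrite -cvg_shiftS.
Qed.

Lemma proximal_correction_cvg : (exists x, sum_op T x 0) ->
  exists zinf : 'rV[R]_n,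
    [/\ sum_op T zinf 0,
        forall i, z k i @[k --> \oo] --> zinf
      & forall i, exists vinf : 'rV[R]_n,
          T i zinf vinf /\ v k i @[k --> \oo] --> vinf].
Proof.
(* Multiplication by [ones^T] sums the rows, which translates between [sum_op] and [primal_dual]. *)
have onesE (X : 'M[R]_(m.+1, n)) : ones^T *m X = \sum_i row i X.
  by rewrite mulmx_sum_row; apply: eq_bigr => i _; rewrite !mxE scale1r.
move=> [x0 [u0 Tu0 sum0]].
have pd0 : primal_dual x0 (\matrix_i u0 i).
  split=> [i|]; first by rewrite rowK.
  by rewrite onesE -[RHS]sum0; apply: eq_bigr => i _; rewrite rowK.
have [x [U [[TU U0] Zx VU]]] := sequences_cvg pd0.
exists x; split.
- by exists (fun i => row i U); [exact: TU | rewrite -onesE U0].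
- move=> i; apply/cvg_mxP => a j; rewrite ord1.
  have /cvg_mxP/(_ i j) := Zx; rewrite !mxE big_ord1 !mxE mul1r.
  by under eq_fun do rewrite mxE.
- move=> i; exists (row i U); split=> //; apply/cvg_mxP => a j; rewrite ord1.
  have /cvg_mxP/(_ i j) := VU; rewrite !mxE.
  by under eq_fun do rewrite mxE.
Qed.

End Dynamics.

Theorem theorem4p2 (R : realType) (m n : nat) (e : rel 'I_m.+1)
    (T : 'I_m.+1 -> 'rV[R]_n -> set 'rV[R]_n) (W Wt : 'M[R]_m.+1) (alpha : R)
    (z v : nat -> 'I_m.+1 -> 'rV[R]_n) :
  connected_undirected_graph e ->
  operator_assumption T ->
  mixing_assumption e W Wt ->
  0 < alpha ->
  proximal_correction T W Wt alpha z v ->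
  exists zinf : 'rV[R]_n,
    [/\ sum_op T zinf 0,
        forall i, z k i @[k --> \oo] --> zinf
      & forall i, exists vinf : 'rV[R]_n,
          T i zinf vinf /\ v k i @[k --> \oo] --> vinf].
Proof.
move=> _ [maxT _ solT] mixW alpha_gt0 pc.
exact: (proximal_correction_cvg maxT mixW alpha_gt0 pc solT).
Qed.
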